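(* Let $k$ be a field, let $S=k[x_1,\ldots,x_n]$, and let $I=(g_1,\ldots,g_m)\subset S$ be a pure square-free monomial ideal of degree $2$, where $\{g_1,\ldots,g_m\}$ is its minimal set of monomial generators. Then $I$ is an $f$-ideal if and only if all of the following hold: (i) $I$ is unmixed with $\operatorname{ht}(I)=n-2$; (ii) $\binom{n}{2}\equiv 0 \pmod 2$; and (iii) $m=\frac{1}{2}\binom{n}{2}$.
   Context: Let $I\subset S=k[x_1,\ldots,x_n]$ be a square-free monomial ideal with minimal set of monomial generators $\{g_1,\ldots,g_m\}$ (distinct square-free monomials). Support: $\operatorname{Supp}(x_1^{a_1}\cdots x_n^{a_n})=\{x_i \mid a_i>0\}$ and $\operatorname{Supp}(I)=\bigcup_{i=1}^m \operatorname{Supp}(g_i)$. Pure square-free monomial ideal of degree $d$ ($d>0$): a square-free monomial ideal $I\subset S=k[x_1,\ldots,x_n]$ with minimal set of monomial generators $\{g_1,\ldots,g_m\}$ such that $\operatorname{Supp}(I)=\{x_1,\ldots,x_n\}$ and every $g_i$ has degree $d$. Facet complex: $\delta_{\mathcal F}(I)$ is the simplicial complex whose facets are $F_i=\{v_j \mid x_j \text{ divides } g_i\}$, $i=1,\ldots,m$; its vertices are the $v_j$ with $x_j\in\operatorname{Supp}(I)$. Non-face (Stanley-Reisner) complex: $\delta_{\mathcal N}(I)$ is the simplicial complex on $v_1,\ldots,v_n$ in which a set $\{v_{i_1},\ldots,v_{i_s}\}$ (distinct indices) is a face if and only if $x_{i_1}\cdots x_{i_s}\notin I$. The dimension of a face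 $F$ is $|F|-1$. The $f$-vector of a $d$-dimensional simplicial complex $\Delta$ is the $(d+1)$-tuple $f(\Delta)=(f_0,f_1,\ldots,f_d)$, where $f_i$ is the number of $i$-dimensional faces of $\Delta$. A square-free monomial ideal $I$ is an $f$-ideal if and only if $\delta_{\mathcal F}(I)$ and $\delta_{\mathcal N}(I)$ have the same $f$-vector. $\operatorname{ht}(I)$ is the height of $I$; $I$ is unmixed if all its associated primes have the same height. *)

(* Defs.v *)
From HB Require Import structures.
From mathcomp Require Import all_boot all_order all_algebra.
From mathcomp Require Import ring_quotient.
From mathcomp.multinomials Require Export mpoly.

Set Implicit Arguments.
Unset Strict Implicit.
Unset Printing Implicit Defensive.

Import GRing.Theory.
Local Open Scope ring_scope.

(* As in ring_quotient, ideals are boolean predicates; [prime_idealr R] is the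
   type of (proper) prime ideals of R. *)
Section Ideals.
Variable R : comNzRingType.
Implicit Types (I : {pred R}) (P Q : prime_idealr R).

Definition ideal_generated_by I (J : finType) (A : {set J}) (g : J -> R)
  : Prop :=
  forall f, f \in I <-> exists c : J -> R, f = \sum_(j in A) c j * g j.

(* There is a strictly increasing chain P_0 < ... < P_h = P of prime ideals. *)
Definition prime_chain_to P (h : nat) : Prop :=
  exists c : 'I_h.+1 -> prime_idealr R,
    c ord_max =i P /\
    forall i j : 'I_h.+1, (i < j)%N ->
      {subset c i <= c j} /\ ~ {subset c j <= c i}.

Definition has_prime_height P (h : nat) : Prop :=
  prime_chain_to P h /\ forall l, prime_chain_to P l -> (l <= h)%N.

Definition has_height I (h : nat) : Prop :=
  (exists P, {subset I <= P} /\ has_prime_height P h) /\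
  forall P l, {subset I <= P} -> has_prime_height P l -> (h <= l)%N.

(* P is the annihilator (I : f) of the class of some f in R / I. *)
Definition associated_prime I P : Prop :=
  exists f : R, forall r : R, (r \in P) = (r * f \in I).

Definition unmixed I : Prop :=
  forall P Q, associated_prime I P -> associated_prime I Q ->
  forall h, has_prime_height P h <-> has_prime_height Q h.

End Ideals.

Section MonomialIdeals.
Variables (k : fieldType) (n m : nat).
Implicit Types (I : {pred {mpoly k[n]}}) (g : 'I_m -> 'X_{1..n}).

Definition minimal_monomial_generators I g : Prop :=
  [/\ injective g,
      ideal_generated_by I [set: 'I_m] (fun i => 'X_[g i]) &
      forall A : {set 'I_m}, A \proper [set: 'I_m] ->
        ~ ideal_generated_by I A (fun i => 'X_[g i])].

Definition squarefree_monomial (t : 'X_{1..n}) : Prop :=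
  forall j : 'I_n, (t j <= 1)%N.

Definition squarefree_monomial_ideal I g : Prop :=
  minimal_monomial_generators I g /\ forall i, squarefree_monomial (g i).

Definition monomial_support (t : 'X_{1..n}) : {set 'I_n} :=
  [set j | (0 < t j)%N].

Definition pure_squarefree_monomial_ideal (d : nat) I g : Prop :=
  [/\ (0 < d)%N,
      squarefree_monomial_ideal I g,
      \bigcup_(i < m) monomial_support (g i) = [set: 'I_n] &
      forall i, mdeg (g i) = d].

(* Simplicial complexes are given by their set of faces, the vertex v_j being
   represented by j. *)
Definition facet_complex g : {set {set 'I_n}} :=
  [set F : {set 'I_n} | [exists i : 'I_m, F \subset monomial_support (g i)]].

Definition nonface_complex I : {set {set 'I_n}} :=
  [set F : {set 'I_n} | \prod_(j in F) 'X_j \notin I].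

(* The length \max_(F in D) #|F| is dim D + 1. *)
Definition f_vector (D : {set {set 'I_n}}) : seq nat :=
  mkseq (fun i => #|[set F in D | #|F| == i.+1]|) (\max_(F in D) #|F|)%N.

Definition f_ideal I g : Prop :=
  f_vector (facet_complex g) = f_vector (nonface_complex I).

End MonomialIdeals.

(* Main.v *)
(** The ideal I is the edge ideal of a graph G on n vertices, and I is an
    f-ideal iff G has independence number 2 and m non-edges, that is
    2 m = 'C(n, 2).  When this holds no vertex is adjacent to all the others:
    the complement of G would be a triangle-free graph on n - 1 vertices with
    n (n - 1) / 4 edges, against Mantel's bound (n - 1)^2 / 4.  Hence every
    independent set lies in a non-edge F, and I is the intersection of the
    coordinate primes P_C = (x_i | i in C) with C = ~: F, all of height n - 2.
    Conversely, an independent 3-set F gives a prime P_(~: F) containing I of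
    height n - 3.

    That P_C has height #|C| rests on a dimension count instead of Krull's
    theorem.  If P < Q are primes, f is in Q but not in P, and the b_u are
    linearly independent modulo Q, then the b_u f^j are linearly independent
    modulo P.  So each step of a chain of primes raises by one the exponent of
    growth of the quotient, which starts at n - #|C| for P_C and cannot exceed
    n. *)

Require Import Defs.
From HB Require Import structures.
From mathcomp Require Import all_boot all_order all_algebra.
From mathcomp Require Import ring_quotient zify.
From mathcomp.multinomials Require Import mpoly.

Set Implicit Arguments.
Unset Strict Implicit.
Unset Printing Implicit Defensive.

Import GRing.Theory.

(** * Mantel's bound on the edges of a triangle-free graph *)

Section Mantel.
Variables (T : finType) (A : {set T}) (H : {set {set T}}).

Let nbhd x := [set y | (y != x) && ([set x; y] \in H)].

(** The second hypothesis is triangle-freeness. The vertex set [A] may be smaller than [T], since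
    the bound is applied below with one vertex removed. *)
Lemma mantel :
    (forall e, e \in H -> #|e| = 2 /\ e \subset A) ->
    (forall F : {set T}, #|F| = 3 ->
       exists2 e : {set T}, e \subset F & (#|e| == 2) && (e \notin H)) ->
  4 * #|H| <= #|A| ^ 2.
Proof.
move=> He Htri.
have nbhdA x : nbhd x \subset A.
  apply/subsetP=> y; rewrite inE => /andP[_ /He[_ /subsetP]]; apply.
  by rewrite !inE eqxx orbT.
have nbhd_indep x p q :
    p != q -> [set p; q] \in H -> ~~ ((p \in nbhd x) && (q \in nbhd x)).
  move=> npq Hpq; rewrite !inE; apply/negP => /and3P[/andP[npx Hp] nqx Hq].
  have c3 : #|[set x; p; q]| = 3.
    by rewrite -setUA cardsU1 !inE cards2 npq !negb_or !(eq_sym x) npx nqx.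
  have [e /subsetP eF /andP[/cards2P[a [b [nab eab]]] eH]] := Htri _ c3.
  case/negP: eH.
  have := eF a; have := eF b; rewrite eab !inE !eqxx orbT => /(_ isT) hb /(_ isT) ha.
  have [C1 C2 C3] : [/\ [set p; x] \in H, [set q; x] \in H & [set q; p] \in H].
    by rewrite ![[set _; x]]setUC [[set q; p]]setUC.
  (* [a] and [b] are among [x], [p], [q]: in each of the nine cases they coincide or form a pair
     already known to be in [H]. *)
  by case/orP: ha hb nab => [/orP[]|] /eqP-> /orP[/orP[]|] /eqP->;
    rewrite ?eqxx // ?Hp ?Hq ?Hpq ?C1 ?C2 ?C3.
case: (set_0Vmem H) => [->|[e0 /He[/eqP/cards2P[x0 _] _]]].
  by rewrite cards0.
(* The neighbourhood of a vertex x of maximal degree d is independent, so each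
   edge meets its complement, whose vertices all have degree at most d. *)
have [x _ xmax] := @arg_maxnP _ x0 xpredT (fun x => #|nbhd x|) isT.
have cover : H \subset \bigcup_(u in A :\: nbhd x) [set [set u; y] | y in nbhd u].
  apply/subsetP=> e eH; have [/eqP/cards2P[p [q [npq epq]]] eA] := He _ eH.
  rewrite {}epq {e} in eH eA *; move: eA; rewrite subUset !sub1set => /andP[pA qA].
  have [px|px] := boolP (p \in nbhd x); apply/bigcupP; last first.
    by exists p; [rewrite inE px|apply/imsetP; exists q; rewrite // inE eq_sym npq].
  have qx : q \notin nbhd x by have := nbhd_indep x _ _ npq eH; rewrite px.
  exists q; first by rewrite inE qx.
  by apply/imsetP; exists p; rewrite 1?setUC // inE npq setUC.
have le1 : #|H| <= #|A :\: nbhd x| * #|nbhd x|.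
  apply: leq_trans (subset_leq_card cover) _.
  apply: (@leq_trans (\sum_(u in A :\: nbhd x) #|nbhd u|)).
    elim/big_ind2: _ => [|s a t b sa tb|u _]; first by rewrite cards0.
    - by apply: leq_trans (leq_add sa tb); rewrite cardsU leq_subr.
    - exact: leq_imset_card.
  by rewrite -sum_nat_const leq_sum // => u _; apply: xmax.
(* [nbhd x] and its complement partition [A], so the AM-GM inequality bounds the product of their
   sizes. *)
move: le1 (nat_AGM2 #|A :\: nbhd x| #|nbhd x|) => le1 [le2 _].
move: (cardsID (nbhd x) A); rewrite (setIidPr (nbhdA x)) addnC => cA.
by rewrite -cA; apply: leq_trans le2; rewrite leq_mul2l.
Qed.

End Mantel.

(** * Prime ideals and chains of primes *)

Section PrimeIdeals.
Local Open Scope ring_scope.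
Variable R : comNzRingType.
Implicit Types P Q : prime_idealr R.

(** Only the top of the chain is replaced, so the length is kept even when P and Q have the same
    elements. *)
Lemma prime_chain_to_sub P Q h :
  {subset P <= Q} -> prime_chain_to P h -> prime_chain_to Q h.
Proof.
move=> PQ [c [cP cS]].
exists (fun i => if i == ord_max then Q else c i); rewrite eqxx; split=> // i j ij.
have -> : (i == ord_max) = false.
  by apply/eqP => iE; move: ij; rewrite iE ltnNge -ltnS ltn_ord.
have [sij nsji] := cS i j ij; case: eqP => [jE|//]; rewrite jE in sij nsji.
split=> [f /sij|Qi]; first by rewrite cP => /PQ.
by apply: nsji => f; rewrite cP => /PQ/Qi.
Qed.

Lemma has_prime_height_uniq P h l :
  has_prime_height P h -> has_prime_height P l -> h = l.
Proof. by case=> ch lh [cl ll]; apply/anti_leq; rewrite lh ?ll. Qed.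

Lemma prime_idealr_prod (I : finType) (A : {set I}) (F : I -> R) P :
  \prod_(i in A) F i \in P -> exists2 i, i \in A & F i \in P.
Proof.
move=> FP; apply/exists_inP; rewrite -[[exists _ in _, _]]negbK negb_exists_in.
apply/negP => /forall_inP nFP; move: FP; apply/negP.
elim/big_ind: _ => [|u v uP vP|//]; first by rewrite idealr1.
by rewrite prime_idealrM negb_or uP.
Qed.

(* The constant term h 0 lies in Q, hence vanishes; then divide by f. *)
Lemma sum_powers_eq0 P Q (f : R) (h : nat -> R) D :
    {subset P <= Q} -> f \in Q -> f \notin P ->
    (forall j, h j \in Q -> h j = 0) ->
  \sum_(j < D) h j * f ^+ j \in P -> forall j, (j < D)%N -> h j = 0.
Proof.
move=> PQ fQ fP; elim: D h => [|D IHD] h h0 //.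
rewrite big_ord_recl expr0 mulr1 /=.
under eq_bigr => j _ do rewrite /bump /= add1n exprS mulrCA.
rewrite -mulr_sumr => sP.
have h00 : h 0%N = 0.
  by apply: h0; move/PQ: sP; rewrite rpredDr // mulrC (idealMr _ fQ).
move: sP; rewrite h00 add0r prime_idealrM (negPf fP) /= => sP [|j] // jD.
by apply: (IHD (fun j => h j.+1)) => // i; apply: h0.
Qed.

End PrimeIdeals.

(** * Growth of quotients by primes and the length of chains *)

Section Growth.
Local Open Scope ring_scope.
Variables (k : fieldType) (n : nat).
Local Notation S := {mpoly k[n]}.
Implicit Types P Q : prime_idealr S.

Lemma msizeM_leq (p q : S) : (msize (p * q) <= (msize p + msize q).-1)%N.
Proof.
have [->|p0] := eqVneq p 0; first by rewrite mul0r msize0.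
have [->|q0] := eqVneq q 0; first by rewrite mulr0 msize0.
by rewrite msizeM.
Qed.

Lemma msizeX_leq (p : S) d : (msize (p ^+ d) <= (d * msize p).+1)%N.
Proof.
elim: d => [|d IHd]; first by rewrite expr0 msize1.
by rewrite exprS; apply: leq_trans (msizeM_leq _ _) _; lia.
Qed.

Definition indep_mod P (U : finType) (b : U -> S) :=
  forall c : U -> k, \sum_u c u *: b u \in P -> forall u, c u = 0.

Lemma idealrZ P c f : f \in P -> c *: f \in P.
Proof. by rewrite -mul_mpolyC; apply: idealMr. Qed.

(** Collecting powers of [f], the coefficient of [f ^+ j] is a combination of the [b u]; such a
    combination lies in [Q] only if it is zero, so [sum_powers_eq0] applies. *)
Lemma indep_mod_step P Q (U : finType) (b : U -> S) f D :
    {subset P <= Q} -> f \in Q -> f \notin P -> indep_mod Q b ->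
  indep_mod P (fun x : U * 'I_D => b x.1 * f ^+ x.2).
Proof.
move=> PQ fQ fP bQ c cP.
pose h j := if insub j is Some i then \sum_u c (u, i) *: b u else 0.
have hE (i : 'I_D) : h i = \sum_u c (u, i) *: b u by rewrite /h valK.
have h0 j : h j \in Q -> h j = 0.
  rewrite /h; case: insubP => // i _ _ /bQ c0.
  by rewrite big1 // => u _; rewrite c0 scale0r.
case=> u i; apply: (bQ (fun u => c (u, i))); rewrite -hE.
rewrite (sum_powers_eq0 PQ fQ fP h0 _ (ltn_ord i)) ?rpred0 //.
congr (_ \in P): cP.
rewrite (eq_bigr (fun x => c (x.1, x.2) *: (b x.1 * f ^+ x.2))); last by case.
rewrite -(pair_bigA _ (fun u (j : 'I_D) => c (u, j) *: (b u * f ^+ j))) /=.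
rewrite exchange_big; apply: eq_bigr => j _; rewrite hE mulr_suml.
by apply: eq_bigr => v _; rewrite scalerAl.
Qed.

(* The Gelfand-Kirillov dimension of the quotient by P is at least t. *)
Definition growth P t := exists e, forall D, exists (U : finType) (b : U -> S),
  [/\ #|U| = (D ^ t)%N, forall u, (msize (b u) <= (D * e).+1)%N
    & indep_mod P b].

Lemma growth0 P : growth P 0.
Proof.
exists 0%N => D; exists unit, (fun=> 1); split => [|_|c]; rewrite ?card_unit ?msize1 //.
rewrite (big_pred1 tt) => [|[]//] cP [].
have [//|c0] := eqVneq (c tt) 0; move/(idealrZ (c tt)^-1): cP.
by rewrite scalerA mulVf // scale1r idealr1.
Qed.

Lemma growthS P Q t f : {subset P <= Q} -> f \in Q -> f \notin P ->
  growth Q t -> growth P t.+1.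
Proof.
(* The factor [f ^+ j] with [j < D] adds at most [D * msize f] to the degree. *)
move=> PQ fQ fP [e Qe]; exists (e + msize f)%N => D.
have [U [b [cU sb bQ]]] := Qe D.
exists (U * 'I_D)%type, (fun x : U * 'I_D => b x.1 * f ^+ x.2); split.
- by rewrite card_prod card_ord cU expnSr.
- move=> [u j] /=; apply: leq_trans (msizeM_leq _ _) _.
  have jD : (j * msize f <= D * msize f)%N by rewrite leq_mul2r ltnW ?ltn_ord ?orbT.
  rewrite mulnDr -subn1 leq_subLR add1n -addSn -addnS.
  by rewrite leq_add // (leq_trans (msizeX_leq f j)).
- exact: indep_mod_step bQ.
Qed.

(** Polynomials of size at most [d] only involve monomials with all exponents below [d], of which
    there are at most [d ^ n]; a larger family has a linear relation, and its sum 0 lies in [P]. *)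
Lemma indep_mod_card P (U : finType) (b : U -> S) d :
    (forall u, (msize (b u) <= d)%N) -> indep_mod P b -> (#|U| <= d ^ n)%N.
Proof.
move=> sb bP; pose W : finType := {ffun 'I_n -> 'I_d}.
have -> : (d ^ n)%N = #|W| by rewrite card_ffun !card_ord.
rewrite leqNgt; apply/negP => ltWU.
pose mon (w : W) : 'X_{1..n} := [multinom (w i : nat) | i < n].
pose M := \matrix_(i < #|U|, j < #|W|) (b (enum_val i))@_(mon (enum_val j)).
have : kermx M != 0.
  rewrite -mxrank_eq0 mxrank_ker subn_eq0 -ltnNge.
  exact: leq_ltn_trans (rank_leq_col M) ltWU.
rewrite -nz_row_eq0; set v := nz_row _ => /eqP; apply.
have vM : v *m M = 0 by apply/sub_kermxP/nz_row_sub.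
pose c u := v 0 (enum_rank u).
suff c0 : \sum_u c u *: b u = 0.
  apply/rowP => i; rewrite mxE -[i]enum_valK; apply: (bP c).
  by rewrite c0 rpred0.
apply/mpolyP => m; rewrite mcoeff0 raddf_sum /=.
have [dm|md] := leqP d (mdeg m).
  rewrite big1 // => u _; rewrite mcoeffZ memN_msupp_eq0 ?mulr0 //.
  exact/msize_mdeg_ge/(leq_trans (sb u)).
have md' (i : 'I_n) : (m i < d)%N.
  by apply: leq_ltn_trans md; rewrite mdegE (bigD1 i) //= leq_addr.
pose w : W := [ffun i => Ordinal (md' i)].
have mw : mon w = m by apply/mnmP => i; rewrite mnmE ffunE.
have /matrixP/(_ 0 (enum_rank w)) := vM; rewrite !mxE => vMw; rewrite -[RHS]vMw.
rewrite (reindex _ (onW_bij _ (@enum_val_bij U))).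
by apply: eq_bigr => i _; rewrite mcoeffZ !mxE enum_rankK mw /c enum_valK.
Qed.

Lemma growth_leq P t : growth P t -> (t <= n)%N.
Proof.
case=> e Pe; rewrite leqNgt; apply/negP => ltnt.
(* This choice gives [(D * e).+1 ^ n <= D ^ n * e.+1 ^ n < D ^ n.+1 <= D ^ t], against
   [indep_mod_card]. *)
pose D := (e.+1 ^ n).+1; have [U [b [cU sb bP]]] := Pe D.
have := indep_mod_card sb bP; rewrite cU; apply/negP; rewrite -ltnNge.
apply: (@leq_ltn_trans ((D * e.+1) ^ n)%N).
  have [n0|n0] := posnP n.
    by rewrite [X in (_ ^ X <= _)%N]n0 [X in (_ <= _ ^ X)%N]n0.
  by rewrite leq_exp2r // mulnS -[leqLHS]add1n leq_add.
apply: (@leq_trans (D ^ n.+1)%N); last by rewrite leq_pexp2l.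
by rewrite expnMn expnSr ltn_pmul2l // expn_gt0.
Qed.

Lemma chain_growth Q h t : prime_chain_to Q h -> growth Q t -> (t + h <= n)%N.
Proof.
case=> c [cQ cS] Qt.
(* Double negation: a failed inclusion of ideals gives no explicit witness. *)
suff gr i : (i <= h)%N -> ~ ~ growth (c (inord (h - i))) (t + i).
  by apply/negPn/negP => lt_n; apply: (gr h (leqnn h)) => /growth_leq; apply/negP.
elim: i => [|i IHi] ih.
  rewrite subn0 addn0; have -> : inord h = ord_max :> 'I_h.+1.
    by apply: val_inj; rewrite /= inordK.
  apply; case: Qt => e Qe; exists e => D; have [U [b [cU sb bQ]]] := Qe D.
  by exists U, b; split => // a; rewrite cQ; apply: bQ.
set a := inord (h - i.+1); set b := inord (h - i) in IHi.
have /cS[sab nsba] : (a < b)%N by rewrite !inordK; lia.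
move=> Ngr; apply: (IHi (ltnW ih)) => gb; apply: nsba => f fb.
apply/negPn/negP => fa; apply: Ngr; rewrite addnS.
exact: growthS fb fa gb.
Qed.

End Growth.

(** * Coordinate primes and their heights *)

Section CoordinatePrimes.
Local Open Scope ring_scope.
Variables (k : fieldType) (n : nat).
Local Notation S := {mpoly k[n]}.
Local Notation supp := (@monomial_support n).
Implicit Types (P Q : prime_idealr S) (C : {set 'I_n}) (m : 'X_{1..n}).

Definition kill_vars C (f : S) : S :=
  f \mPo [tuple if i \in C then 0 else 'X_i | i < n].

Lemma kill_varsX C m :
  kill_vars C 'X_[m] = if [disjoint supp m & C] then 'X_[m] else 0.
Proof.
rewrite /kill_vars comp_mpolyX; case: ifPn => [dmC|/pred0Pn[i /andP[/=]]].
  rewrite [RHS]mpolyXE_id; apply: eq_bigr => i _; rewrite tnth_mktuple.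
  case: ifP => // iC; have : i \notin supp m by rewrite (disjointFl dmC).
  by rewrite inE -eqn0Ngt => /eqP->; rewrite !expr0.
rewrite inE => mi iC; rewrite (bigD1 i) //= tnth_mktuple iC expr0n.
by rewrite (gtn_eqF mi) mul0r.
Qed.

Lemma mcoeff_kill_vars C f m :
  (kill_vars C f)@_m = if [disjoint supp m & C] then f@_m else 0.
Proof.
rewrite /kill_vars comp_mpolyEX raddf_sum /=.
rewrite [in RHS](mpolyE f) raddf_sum /=.
transitivity (\sum_(m' <- msupp f)
    if [disjoint supp m & C] then (f@_m' *: 'X_[m'] : S)@_m else 0).
  apply: eq_bigr => m' _; rewrite !mcoeffZ -/(kill_vars C _) kill_varsX.
  rewrite !mcoeffX; case: eqP => [->|/eqP mm'].
    by case: ifP; rewrite ?mcoeff0 ?mulr0 // mcoeffX eqxx.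
  by rewrite mulr0 if_same; case: ifP; rewrite ?mcoeff0 ?mcoeffX ?(negPf mm') mulr0.
by case: ifP => // _; rewrite big1.
Qed.

(** The prime (x_i | i in C), taken as the kernel of a ring endomorphism of a domain so that
    primality is immediate. *)
Definition coord_prime C : pred S := fun f => kill_vars C f == 0.

Lemma coord_primeP C f :
  reflect {in msupp f, forall m, ~~ [disjoint supp m & C]} (f \in coord_prime C).
Proof.
apply: (iffP eqP) => [f0 m|fC].
  rewrite mcoeff_msupp; apply: contra => dmC.
  by move/mpolyP/(_ m): f0; rewrite mcoeff_kill_vars dmC mcoeff0 => ->.
apply/mpolyP => m; rewrite mcoeff_kill_vars mcoeff0; case: ifP => // dmC.
by apply: memN_msupp_eq0; apply/negP => /fC; rewrite dmC.
Qed.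

Lemma coord_prime_idealr_closed C : idealr_closed (coord_prime C).
Proof.
split; rewrite ?unfold_in /coord_prime /kill_vars.
- by rewrite comp_mpoly0.
- by rewrite comp_mpoly1 oner_eq0.
- move=> a u v; rewrite !unfold_in /coord_prime /kill_vars => /eqP u0 /eqP v0.
  by rewrite rmorphD rmorphM /= u0 v0 mulr0 addr0.
Qed.

Lemma coord_prime_prime C : prime_idealr_closed (coord_prime C).
Proof.
move=> u v; rewrite !unfold_in /coord_prime /kill_vars.
by rewrite rmorphM /= mulf_eq0.
Qed.

HB.instance Definition _ C :=
  isIdealr.Build S (coord_prime C) (@coord_prime_idealr_closed C).
HB.instance Definition _ C :=
  isPrimeIdealrClosed.Build S (coord_prime C) (@coord_prime_prime C).

Lemma monomial_supportU (i : 'I_n) : supp U_(i)%MM = [set i].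
Proof. by apply/setP => j; rewrite !inE mnm1E eq_sym; case: eqP. Qed.

Lemma mem_coord_primeX C m : ('X_[m] \in coord_prime C) = ~~ [disjoint supp m & C].
Proof.
apply/coord_primeP/idP => [|dmC m']; first by apply; rewrite msuppX mem_seq1.
by rewrite msuppX mem_seq1 => /eqP->.
Qed.

Lemma mem_coord_primeXU C i : ('X_i \in coord_prime C) = (i \in C).
Proof. by rewrite mem_coord_primeX monomial_supportU disjoints1 negbK. Qed.

Lemma mpoly_mem P (f : S) : {in msupp f, forall m, 'X_[m] \in P} -> f \in P.
Proof.
move=> fP; rewrite [f]mpolyE big_seq; apply: rpred_sum => m /fP.
exact: idealrZ.
Qed.

Lemma sub_coord_prime C P :
  (forall i, i \in C -> 'X_i \in P) -> {subset coord_prime C <= P}.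
Proof.
move=> CP f /coord_primeP fC; apply: mpoly_mem => m /fC /pred0Pn[i /andP[/=]].
rewrite inE => mi /CP iP; rewrite -[m](@submK _ U_(i)%MM) ?lep1mP -?lt0n //.
by rewrite mpolyXD idealMr.
Qed.

(** Induction starting from the set of all variables: for i outside C, x_i lies in the prime of
    [i |: C] but not in that of C, and [growthS] gains one. *)
Lemma growth_coord_prime C : growth (coord_prime C) (n - #|C|).
Proof.
have [d] := ubnP (n - #|C|); elim: d => // d IHd in C *.
have [C1|[i iC]] := set_0Vmem (~: C); rewrite ltnS => ltd.
  have -> : C = setT by rewrite -[C]setCK C1 setC0.
  by rewrite cardsT card_ord subnn; apply: growth0.
rewrite inE in iC; have cC : #|i |: C| = #|C|.+1 by rewrite cardsU1 iC.
have := max_card (mem (i |: C)); rewrite cC card_ord => ltCn.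
rewrite -[(n - #|C|)%N]prednK ?subn_gt0 // -subnS -cC.
apply: (@growthS _ _ _ (coord_prime (i |: C)) _ 'X_i).
- by apply: sub_coord_prime => j jC; rewrite mem_coord_primeXU inE jC orbT.
- by rewrite mem_coord_primeXU setU11.
- by rewrite mem_coord_primeXU.
- by apply: IHd; rewrite cC; apply: leq_trans ltd; rewrite ltn_sub2l // ltnS.
Qed.

(** Adding the elements of C one at a time gives a chain of length [#|C|]; the growth exponent
    [n - #|C|] leaves room for no longer one. *)
Lemma has_prime_height_coord_prime C :
  has_prime_height (coord_prime C : prime_idealr S) #|C|.
Proof.
split=> [|l /chain_growth/(_ (growth_coord_prime C))]; last first.
  by rewrite -leq_subRL ?leq_subr // subKn // -[n in (_ <= n)%N]card_ord max_card.
pose T (i : nat) := [set x in take i (enum C)].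
exists (fun i => coord_prime (T i)); split=> [f|i j ij].
  suff -> : T (@ord_max #|C|) = C by [].
  by apply/setP => x; rewrite inE take_oversize -?cardE // mem_enum.
split=> [|sub].
  apply: sub_coord_prime => x; rewrite mem_coord_primeXU !inE.
  by rewrite -(subnKC (ltnW ij)) takeD mem_cat => ->.
have jC : (j <= size (enum C))%N by rewrite -cardE -ltnS ltn_ord.
have iC := leq_trans ij jC.
have [x0 _] : exists x, x \in C by apply/card_gt0P; rewrite cardE (leq_trans _ iC).
(* The entry of index [i], counted from 0, is among the first [j] elements of [C] but not among the
   first [i]. *)
have := sub 'X_(nth x0 (enum C) i); rewrite !mem_coord_primeXU !inE.
by rewrite !in_take_leq ?index_uniq ?enum_uniq ?ltnn ?ij ?(ltnW iC) // => /(_ isT).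
Qed.

(** If P contained no P_C, each C would have a variable outside P; the product of these variables
    lies in all the P_C, hence in P, contradicting primality. *)
Lemma sub_prime_bigcap (A : {set {set 'I_n}}) P :
    (forall f, {in A, forall C, f \in coord_prime C} -> f \in P) ->
  exists2 C, C \in A & {subset coord_prime C <= P}.
Proof.
move=> AP.
have [/exists_inP[C CA /forall_inP CP]|] :=
  boolP [exists C in A, [forall i in C, 'X_i \in P]].
  by exists C => //; apply: sub_coord_prime.
rewrite negb_exists_in => /forall_inP nA.
pose F (C : {set 'I_n}) : S :=
  if [pick i in C | 'X_i \notin P] is Some i then 'X_i else 1.
have [|C CA] := @prime_idealr_prod _ _ A F P.
  apply: AP => C CA; rewrite (bigD1 C) //= mulrC idealMr // /F.
  have := nA C CA; rewrite negb_forall_in => /exists_inP[i iC iP].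
  case: pickP => [j /andP[jC _]|/(_ i)]; first by rewrite mem_coord_primeXU.
  by rewrite iC iP.
rewrite /F; case: pickP => [i /andP[_ /negP]//|_]; by rewrite idealr1.
Qed.

End CoordinatePrimes.

(** * Membership in monomial ideals and square-free monomials *)

Section MonomialIdeals.
Local Open Scope ring_scope.
Variables (k : fieldType) (n m : nat).
Local Notation S := {mpoly k[n]}.
Local Notation supp := (@monomial_support n).
Implicit Types (t u : 'X_{1..n}) (F : {set 'I_n}).

Lemma mem_monomial_ideal (I : {pred S}) (g : 'I_m -> 'X_{1..n}) (f : S) :
    ideal_generated_by I [set: 'I_m] (fun i => 'X_[g i]) ->
  f \in I <-> {in msupp f, forall t, [exists i, (g i <= t)%MM]}.
Proof.
move=> Igen; split=> [/Igen[c ->] t /msupp_sum_le/flattenP[s]|].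
  case/mapP=> i _ -> /msuppM_le/allpairsP[[t1 t2] /= [_]].
  by rewrite msuppX mem_seq1 => /eqP-> ->; apply/existsP; exists i; rewrite lem_addl.
rewrite [in f \in I](mpolyE f) big_seq => fg.
elim/big_ind: _ => [|u v /Igen[c ->] /Igen[d ->]|t /fg/existsP[i git]]; apply/Igen.
- by exists (fun=> 0); rewrite big1 // => i _; rewrite mul0r.
- exists (fun i => c i + d i); rewrite -big_split.
  by apply: eq_bigr => i _; rewrite mulrDl.
exists (fun j => if j == i then f@_t *: 'X_[t - g i] else 0).
rewrite (bigD1 i) ?inE //= eqxx big1 ?addr0; last first.
  by move=> j /andP[_ /negPf->]; rewrite mul0r.
by rewrite -scalerAl -mpolyXD submK.
Qed.

Lemma mnm_squarefree t i : squarefree_monomial t -> t i = (i \in supp t).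
Proof. by move=> /(_ i); rewrite inE; case: (t i) => [|[]]. Qed.

Lemma mdeg_squarefree t : squarefree_monomial t -> mdeg t = #|supp t|.
Proof.
move=> sqt; rewrite mdegE -sum1_card [RHS]big_mkcond /=.
by apply: eq_bigr => i _; rewrite mnm_squarefree //; case: (_ \in _).
Qed.

Lemma squarefree_supp_inj t u :
  squarefree_monomial t -> squarefree_monomial u -> supp t = supp u -> t = u.
Proof. by move=> sqt squ tu; apply/mnmP => i; rewrite !mnm_squarefree // tu. Qed.

Lemma squarefree_lem t u :
  squarefree_monomial t -> (t <= u)%MM = (supp t \subset supp u).
Proof.
move=> sqt; apply/mnm_lepP/subsetP => tu i.
  by rewrite !inE => ti; apply: leq_trans ti (tu i).
by rewrite mnm_squarefree //; have [/tu|//] := boolP (i \in _); rewrite inE.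
Qed.

Lemma prod_varsE F :
  exists2 t, \prod_(j in F) 'X_j = 'X_[t] :> S & supp t = F.
Proof.
exists (\sum_(j in F) U_(j))%MM; first apply/esym.
  by apply: (big_morph (@mpolyX n k)) => [t u|]; rewrite ?mpolyXD ?mpolyX0.
apply/setP => i; rewrite inE mnm_sumE.
have [iF|iF] := boolP (i \in F); first by rewrite (bigD1 i) //= mnm1E eqxx.
rewrite big1 // => j jF; rewrite mnm1E; case: eqP => // ij.
by rewrite -ij jF in iF.
Qed.

End MonomialIdeals.

(** * Edge ideals, independent sets and f-vectors *)

Section EdgeIdeals.
Variables (k : fieldType) (n m : nat).
Variables (I : {pred {mpoly k[n]}}) (g : 'I_m -> 'X_{1..n}).
Hypothesis n_gt0 : 0 < n.
Hypothesis pureI : pure_squarefree_monomial_ideal 2 I g.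
Local Notation supp := (@monomial_support n).
Implicit Types (F : {set 'I_n}).

Let edge i := supp (g i).

Let sqg i : squarefree_monomial (g i). Proof. by case: pureI => _ []. Qed.

Let edge_inj : injective edge.
Proof.
case: pureI => _ [[inj_g _ _] _] _ _ i j /squarefree_supp_inj ij; exact/inj_g/ij.
Qed.

Let card_edge i : #|edge i| = 2.
Proof. by rewrite -mdeg_squarefree //; case: pureI. Qed.

Let m_gt0 : 0 < m.
Proof.
have [_ _ gT _] := pureI.
have : Ordinal n_gt0 \in \bigcup_(i < m) edge i by rewrite gT inE.
by case/bigcupP => i _ _; apply: leq_ltn_trans (ltn_ord i).
Qed.

Definition indep F := ~~ [exists i, edge i \subset F].

Definition nonedges := [set F : {set 'I_n} | (#|F| == 2) && indep F].

(** The generators are square-free, so whether one divides a monomial depends only on the support of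
    that monomial. *)
Lemma mem_edge_ideal f : (f \in I) = all (fun t => ~~ indep (supp t)) (msupp f).
Proof.
have [_ [[_ Igen _] _] _ _] := pureI; have memI := mem_monomial_ideal f Igen.
apply/idP/allP => [/memI fg t /fg/existsP[i]|fg].
  by rewrite squarefree_lem // negbK => it; apply/existsP; exists i.
apply/memI => t /fg; rewrite negbK => /existsP[i it].
by apply/existsP; exists i; rewrite squarefree_lem.
Qed.

Lemma mem_nonface F : (F \in nonface_complex I) = indep F.
Proof.
rewrite inE; have [t -> tF] := prod_varsE k F.
by rewrite mem_edge_ideal msuppX /= andbT negbK tF.
Qed.

Lemma indep_edge F : #|F| = 2 -> ~~ indep F -> exists i, F = edge i.
Proof.
move=> cF /negPn/existsP[i iF]; exists i; apply/esym/eqP.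
by rewrite eqEcard iF card_edge cF.
Qed.

Lemma edge_nindep i : ~~ indep (edge i).
Proof. by rewrite negbK; apply/existsP; exists i. Qed.

Lemma card_nonedges : #|nonedges| + m = 'C(n, 2).
Proof.
rewrite -[n in 'C(n, _)]card_ord -card_draws.
rewrite -[RHS](cardsID [set F : {set 'I_n} | indep F]).
congr (_ + _); first by apply: eq_card => F; rewrite !inE.
rewrite -[LHS]card_ord -(card_imset _ edge_inj); apply: eq_card => F; rewrite !inE.
apply/imsetP/andP => [[i _ ->]|[nF /eqP /indep_edge]].
  by rewrite card_edge edge_nindep.
by case/(_ nF) => i ->; exists i.
Qed.

(** The facet complex is the graph itself, of dimension 1. All n vertices are faces of both
    complexes, so what remains to compare is the dimension and the number of 1-faces. *)
Lemma f_idealP :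
  f_ideal I g <-> (forall F, indep F -> #|F| <= 2) /\ #|nonedges| = m.
Proof.
have facet_max : \max_(F in facet_complex g) #|F| = 2.
  apply/anti_leq/andP; split.
    apply/bigmax_leqP => F; rewrite inE => /existsP[i /subset_leq_card].
    by rewrite card_edge.
  rewrite -(card_edge (Ordinal m_gt0)); apply: leq_bigmax_cond.
  by rewrite inE; apply/existsP; exists (Ordinal m_gt0).
have facet2 : #|[set F in facet_complex g | #|F| == 2]| = m.
  rewrite -[RHS]card_ord -(card_imset _ edge_inj); apply: eq_card => F; rewrite !inE.
  apply/andP/imsetP => [[/existsP[i Fi] /eqP cF]|[i _ ->]].
    by exists i => //; apply/eqP; rewrite eqEcard Fi card_edge cF.
  by rewrite card_edge; split => //; apply/existsP; exists i.
have nonface2 : #|[set F in nonface_complex I | #|F| == 2]| = #|nonedges|.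
  by apply: eq_card => F; rewrite inE mem_nonface inE andbC.
rewrite /f_ideal /f_vector facet_max; split=> [fv|[alpha2 cN]].
  have nmax : \max_(F in nonface_complex I) #|F| = 2.
    by move/(congr1 size): fv; rewrite !size_mkseq.
  split=> [F iF|]; first by rewrite -nmax; apply: leq_bigmax_cond; rewrite mem_nonface.
  move: fv; rewrite nmax => /(congr1 (nth 0 ^~ 1)).
  by rewrite !nth_mkseq // facet2 nonface2.
have -> : \max_(F in nonface_complex I) #|F| = 2.
  apply/anti_leq/andP; split.
    by apply/bigmax_leqP => F; rewrite mem_nonface; apply: alpha2.
  have /card_gt0P[F] : 0 < #|nonedges| by rewrite cN.
  by rewrite inE => /andP[/eqP <- iF]; apply: leq_bigmax_cond; rewrite mem_nonface.
congr [:: _; _]; last by rewrite facet2 nonface2 cN.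
apply: eq_card => F; rewrite [LHS]inE [RHS]inE mem_nonface.
case: eqP => [/eqP/cards1P[x ->]|]; last by rewrite !andbF.
(* Every singleton is a face of both complexes: its vertex lies in an edge, and no edge fits inside
   it. *)
have [_ _ gT _] := pureI.
have : x \in \bigcup_(i < m) edge i by rewrite gT inE.
case/bigcupP => i _ xi; rewrite !andbT inE; transitivity true.
  by apply/existsP; exists i; rewrite sub1set.
apply/esym/negP => /existsP[j /subset_leq_card].
by rewrite card_edge cards1.
Qed.

Lemma indep_sub_nonedge F :
    (forall F, indep F -> #|F| <= 2) -> #|nonedges| = m -> indep F ->
  exists2 F', F' \in nonedges & F \subset F'.
Proof.
move=> alpha2 cN iF; have := alpha2 F iF; rewrite leq_eqVlt ltnS leq_eqVlt.
case/or3P => [c2|/cards1P[v ->]|].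
- by exists F; rewrite // inE c2.
- have [/exists_inP[F' F'N vF']|] := boolP [exists F' in nonedges, v \in F'].
    by exists F' => //; rewrite sub1set.
  rewrite negb_exists_in => /forall_inP Nv.
  (* Here [v] is adjacent to all other vertices, so the non-edges form a graph on the remaining n -
     1 vertices. *)
  have := @mantel _ (~: [set v]) nonedges.
  rewrite cN cardsC1 card_ord => le4.
  have : 4 * m <= n.-1 ^ 2.
    apply: le4 => [e eN|F3 cF3].
      have := Nv e eN; move: eN; rewrite inE => /andP[/eqP-> _] ve; split=> //.
      by rewrite subsetC sub1set inE.
    have : ~~ indep F3 by apply: contraTN isT => /alpha2; rewrite cF3.
    rewrite negbK => /existsP[i iF3]; exists (edge i) => //.
    by rewrite card_edge inE (negPf (edge_nindep i)) andbF.
  (* Now n (n - 1) = 2 'C(n, 2) = 4 m <= (n - 1)^2, which forces n = 1 and m = 0. *)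
  have := mul_bin_diag n 1; rewrite bin1 -card_nonedges cN => nm.
  have np : n = n.-1 + 1 by rewrite addn1 prednK.
  by move: np nm m_gt0; rewrite -mulnn; move: n.-1 => p; nia.
rewrite ltnS leqn0 cards_eq0 => /eqP->.
have /card_gt0P[F' F'N] : 0 < #|nonedges| by rewrite cN.
by exists F' => //; rewrite sub0set.
Qed.

Lemma sub_coord_prime_indep F : indep F -> {subset I <= @coord_prime k n (~: F)}.
Proof.
move=> iF f; rewrite mem_edge_ideal => /allP fI; apply/coord_primeP => t /fI.
apply: contra; rewrite disjoints_subset setCK => tF.
apply: contra iF => /existsP[i it]; apply/existsP; exists i; exact: subset_trans it tF.
Qed.

(** A monomial outside I has independent support, which lies inside some non-edge F; the monomial is
    then outside P_(~: F). *)
Lemma edge_ideal_bigcap f :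
    (forall F, indep F -> #|F| <= 2) -> #|nonedges| = m ->
  (f \in I) = [forall F in nonedges, f \in @coord_prime k n (~: F)].
Proof.
move=> alpha2 cN; apply/idP/forall_inP => [fI F|fP].
  by rewrite inE => /andP[_ /sub_coord_prime_indep]; apply.
rewrite mem_edge_ideal; apply/allP => t tf; apply/negP => /indep_sub_nonedge.
case/(_ alpha2 cN) => F /fP /coord_primeP/(_ t tf).
by rewrite disjoints_subset setCK => /negP.
Qed.

Lemma card_setC_nonedge F : F \in nonedges -> #|~: F| = n - 2.
Proof. by rewrite inE => /andP[/eqP cF _]; rewrite cardsCs setCK card_ord cF. Qed.

Lemma f_ideal_unmixed :
    (forall F, indep F -> #|F| <= 2) -> #|nonedges| = m ->
  unmixed I /\ has_height I (n - 2).
Proof.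
move=> alpha2 cN.
pose NC := [set ~: F | F in nonedges].
have memI f : (f \in I) = [forall C in NC, f \in @coord_prime k n C].
  rewrite (edge_ideal_bigcap f alpha2 cN); apply/forall_inP/forall_inP => fP C.
    by case/imsetP => F /fP fF ->.
  by move=> CN; apply/fP/imset_f.
have cardNC C : C \in NC -> #|C| = n - 2.
  by case/imsetP => F /card_setC_nonedge cF ->.
have htNC C :
    C \in NC -> has_prime_height (@coord_prime k n C : prime_idealr _) (n - 2).
  by move/cardNC <-; apply: has_prime_height_coord_prime.
split; last first.
  have /card_gt0P[F FN] : 0 < #|nonedges| by rewrite cN.
  split; first exists (@coord_prime k n (~: F)).
    split; last by apply/htNC/imset_f.
    by apply: sub_coord_prime_indep; move: FN; rewrite inE => /andP[].
  (* A prime over I contains the intersection of the P_C, hence one of them, and inherits a chain of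
     length n - 2 from it. *)
  move=> P l IP [_]; apply.
  have [|C CN CP] := @sub_prime_bigcap _ _ NC P.
    by move=> f fC; apply: IP; rewrite memI; apply/forall_inP.
  exact: prime_chain_to_sub CP (htNC C CN).1.
suff assP P : associated_prime I P -> has_prime_height P (n - 2).
  move=> P Q /assP hP /assP hQ h; split=> hh.
    by rewrite (has_prime_height_uniq hh hP).
  by rewrite (has_prime_height_uniq hh hQ).
(* The annihilator (I : f) is the intersection of the P_C that do not contain f; being prime, it
   equals one of them. *)
case=> f fP; pose A := [set C in NC | f \notin @coord_prime k n C].
have memP r : (r \in P) = [forall C in A, r \in @coord_prime k n C].
  rewrite fP memI; apply/forall_inP/forall_inP => rP C.
    by rewrite inE => /andP[/rP]; rewrite prime_idealrM => /orP[|->].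
  move=> CN; rewrite prime_idealrM; have [|fC] := boolP (f \in _);
    rewrite ?orbT // orbF.
  by apply: rP; rewrite inE CN.
have [|C CA CP] := @sub_prime_bigcap _ _ A P.
  by move=> r rA; rewrite memP; apply/forall_inP.
have PC : @coord_prime k n C =i P.
  by move=> r; apply/idP/idP => [/CP//|]; rewrite memP => /forall_inP/(_ C CA).
move: CA; rewrite inE => /andP[/htNC[chC maxC] _]; split.
  by apply: prime_chain_to_sub chC.
move=> l chl; apply: maxC; apply: prime_chain_to_sub chl => r.
by rewrite PC.
Qed.

Lemma height_indep : has_height I (n - 2) -> forall F, indep F -> #|F| <= 2.
Proof.
case=> _ minh F iF.
have := minh (@coord_prime k n (~: F)) _ (sub_coord_prime_indep iF)
             (has_prime_height_coord_prime _ _).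
have := max_card (mem (edge (Ordinal m_gt0))); rewrite card_ord card_edge => n_ge2.
by rewrite [#|F|]cardsCs card_ord; lia.
Qed.

End EdgeIdeals.

Theorem theorem3p5 (k : fieldType) (n m : nat) (I : {pred {mpoly k[n]}})
    (g : 'I_m -> 'X_{1..n}) :
  (0 < n)%N ->
  pure_squarefree_monomial_ideal 2 I g ->
  f_ideal I g <->
  [/\ unmixed I /\ has_height I (n - 2)%N,
      'C(n, 2) = 0 %[mod 2] &
      (m%:R = 2%:R^-1 * 'C(n, 2)%:R :> rat)%R].
Proof.
move=> n_gt0 pureI; have cN := card_nonedges pureI.
(* By [card_nonedges], condition (iii) says that there are as many non-edges as edges. *)
have half : (m%:R = 2%:R^-1 * 'C(n, 2)%:R :> rat)%R <-> #|nonedges g| = m.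
  have mE : (m%:R = 2%:R^-1 * (2 * m)%:R :> rat)%R.
    by rewrite natrM mulrA mulVf // mul1r.
  split=> [|Nm]; last by rewrite -cN Nm addnn -mul2n.
  rewrite {1}mE => /(mulfI _)/eqP; rewrite invr_eq0 Num.Theory.eqr_nat => /(_ isT).
  by rewrite -cN; lia.
split=> [/(f_idealP n_gt0 pureI)[alpha2 Nm]|[[_ ht] _ /half Nm]].
  split; [exact: (f_ideal_unmixed n_gt0 pureI alpha2 Nm) | | exact/half].
  by rewrite -cN Nm addnn -muln2 modnMl.
by apply/f_idealP => //; split=> //; apply: (height_indep n_gt0 pureI ht).
Qed.
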